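(* Let $(X,d)$ be a metric space, let $p\in X$, and let $D=X\setminus\{p\}$. Then for all $x,y\in D$, $$\frac{j^*_D(x,y)}{2}\le \tanh\left(\frac{\tau_p(x,y)}{2}\right)\le 2\,j^*_D(x,y).$$ Moreover, the right inequality is sharp for $D=\mathbb{R}^n\setminus\{0\}$ (that is, $X=\mathbb{R}^n$ with the Euclidean metric, $n\ge 2$, and $p=0$): the constant $2$ in the right inequality cannot be replaced by any smaller constant.
   Context: For a metric space $(X,d)$ and $p\in X$, the scale-invariant Cassinian metric on $X\setminus\{p\}$ is $$\tau_p(x,y)=\log\left(1+2\frac{d(x,y)}{\sqrt{d(x,p)\,d(y,p)}}\right),\quad x,y\in X\setminus\{p\}.$$ For $D=X\setminus\{p\}$, the distance ratio metric is $$\tilde{j}_D(x,y)=\log\left(1+\frac{d(x,y)}{\min\{d(x,p),d(y,p)\}}\right),\quad x,y\in D,$$ and $j^*_D(x,y)=\tanh\left(\tilde{j}_D(x,y)/2\right)$. *)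

(* Defs.v *)
From HB Require Import structures.
From mathcomp Require Import all_boot all_order all_algebra.
From mathcomp Require Import all_classical all_reals all_analysis.
From mathcomp Require Import ring lra.

Set Implicit Arguments.
Unset Strict Implicit.
Unset Printing Implicit Defensive.

Import Order.TTheory GRing.Theory Num.Theory.
Import numFieldNormedType.Exports.

Local Open Scope ring_scope.

Definition tanh (R : realType) (x : R) : R :=
  (expR x - expR (- x)) / (expR x + expR (- x)).

(* The functions below are total; only their values at points distinct from [p]
   are meaningful. *)

Definition tau (R : realType) (X : metricType R) (p x y : X) : R :=
  ln (1 + 2 * (mdist x y / Num.sqrt (mdist x p * mdist y p))).

(* Here the domain is D = X \ {p}. *)
Definition jtilde (R : realType) (X : metricType R) (p x y : X) : R :=
  ln (1 + mdist x y / Num.min (mdist x p) (mdist y p)).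

Definition jstar (R : realType) (X : metricType R) (p x y : X) : R :=
  tanh (jtilde p x y / 2).

(* An alias of ['rV[R]_n] is needed because the canonical (pseudo)metric of
   ['rV[R]_n] is the one of the sup norm. *)
Definition euclidean (R : realType) (n : nat) : Type := 'rV[R]_n.

HB.instance Definition _ (R : realType) (n : nat) :=
  GRing.Lmodule.on (euclidean R n).

Definition edist (R : realType) (n : nat) (x y : euclidean R n) : R :=
  Num.sqrt (\sum_(i < n) ((x : 'rV[R]_n) 0 i - (y : 'rV[R]_n) 0 i) ^+ 2).

Section euclidean_metric.
Context {R : realType} {n : nat}.
Implicit Types (x y z : euclidean R n) (a b : 'I_n -> R).

Let sqsum_ge0 a : 0 <= \sum_i a i ^+ 2.
Proof. by apply: sumr_ge0 => i _; exact: sqr_ge0. Qed.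

Let sqsum_eq0 a : Num.sqrt (\sum_i a i ^+ 2) = 0 -> forall i, a i = 0.
Proof.
move=> /eqP; rewrite sqrtr_eq0 => le0 i; apply/eqP; rewrite -sqrf_eq0.
have /eqP : \sum_i a i ^+ 2 = 0 by apply/le_anti; rewrite le0 sqsum_ge0.
by rewrite psumr_eq0 => [/allP/(_ i)|j _]; [apply; rewrite mem_index_enum
                                           |exact: sqr_ge0].
Qed.

Let cauchy_schwarz a b :
  \sum_i a i * b i <=
  Num.sqrt (\sum_i a i ^+ 2) * Num.sqrt (\sum_i b i ^+ 2).
Proof.
have /sqr_sqrtr := sqsum_ge0 a; have /sqr_sqrtr := sqsum_ge0 b.
set A := Num.sqrt (\sum_i a i ^+ 2); set B := Num.sqrt (\sum_i b i ^+ 2).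
move=> EB EA.
have [A0|A0] := eqVneq A 0.
  by rewrite big1 ?A0 ?mul0r// => i _; rewrite (sqsum_eq0 A0) mul0r.
have [B0|B0] := eqVneq B 0.
  by rewrite big1 ?B0 ?mulr0// => i _; rewrite (sqsum_eq0 B0) mulr0.
have AB : 0 < A * B by rewrite mulr_gt0// lt_neqAle eq_sym ?A0 ?B0 sqrtr_ge0.
have : 0 <= \sum_i (B * a i - A * b i) ^+ 2 by exact: sqsum_ge0.
have -> : \sum_i (B * a i - A * b i) ^+ 2 =
          2 * (A * B) * (A * B - \sum_i a i * b i).
  transitivity (\sum_i (B ^+ 2 * a i ^+ 2 - 2 * (A * B) * (a i * b i)
                         + A ^+ 2 * b i ^+ 2)).
    by apply: eq_bigr => i _; ring.
  by rewrite big_split sumrB /= -!mulr_sumr -EA -EB; ring.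
by rewrite pmulr_rge0 ?subr_ge0// mulr_gt0.
Qed.

Let minkowski a b :
  Num.sqrt (\sum_i (a i + b i) ^+ 2) <=
  Num.sqrt (\sum_i a i ^+ 2) + Num.sqrt (\sum_i b i ^+ 2).
Proof.
rewrite -[leRHS]ger0_norm ?addr_ge0 ?sqrtr_ge0// -sqrtr_sqr ler_wsqrtr//.
rewrite sqrrD !sqr_sqrtr ?sqsum_ge0//.
under eq_bigr => i _ do rewrite sqrrD.
by rewrite big_split/= lerD2r big_split/= lerD2l sumrMnl lerMn2r cauchy_schwarz.
Qed.

Let edistxx x : edist x x = 0.
Proof. by rewrite /edist big1 ?sqrtr0// => i _; rewrite subrr expr0n. Qed.

Let edist_positivity x y : edist x y = 0 -> x = y.
Proof.
move=> /sqsum_eq0 xy; apply/rowP => i.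
by apply/eqP; rewrite -subr_eq0; apply/eqP; exact: xy.
Qed.

Let edist_sym x y : edist x y = edist y x.
Proof.
by congr Num.sqrt; apply: eq_bigr => i _; rewrite -sqrrN opprB.
Qed.

Let edist_triangle y x z : edist x z <= edist x y + edist y z.
Proof.
apply: le_trans (minkowski _ _); apply: ler_wsqrtr.
by under [leRHS]eq_bigr => i _ do rewrite addrA subrK.
Qed.

HB.instance Definition _ := @isMetric.Build R (euclidean R n)
  (@edist R n) edistxx edist_positivity edist_sym edist_triangle.

End euclidean_metric.

(* Main.v *)
(** Since tanh (ln (1 + t) / 2) = t / (t + 2), writing d = d(x,y), m and M for
    the smaller and larger distance to p, and s = sqrt (m M), the two sides are
    j* = d / (d + 2m) and tanh (tau / 2) = d / (d + s).  The bounds then reduce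
    to m <= s <= M <= m + d.  The constant 2 is approached by x = e,
    y = (1 + eps) e for a unit vector e, as eps tends to 0. *)
Require Import Defs.
From mathcomp Require Import all_boot all_order all_algebra.
From mathcomp Require Import all_classical all_reals all_analysis.
From mathcomp Require Import ring lra.
Import Order.TTheory GRing.Theory Num.Theory.
Import numFieldNormedType.Exports.
Local Open Scope ring_scope.

Lemma tanh_half_ln1D (R : realType) (t : R) : 0 <= t ->
  tanh (ln (1 + t) / 2) = t / (t + 2).
Proof.
move=> t0; rewrite /tanh expRN.
(* Here [u] is the square root of [1 + t], and [tanh] of the half logarithm is [(u - 1/u) / (u +
   1/u) = (u^2 - 1) / (u^2 + 1)]. *)
set u := expR _; have u0 : 0 < u by exact: expR_gt0.
have uu : u * u = 1 + t.
  by rewrite -expRD -splitr lnK// posrE; lra.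
have -> : t = u * u - 1 by lra.
by field; rewrite !gt_eqF//; nra.
Qed.

Lemma jstarE (R : realType) (X : metricType R) (p x y : X) :
  x != p -> y != p ->
  jstar p x y =
  mdist x y / (mdist x y + 2 * Num.min (mdist x p) (mdist y p)).
Proof.
move=> xp yp; rewrite /jstar /jtilde.
have m0 : 0 < Num.min (mdist x p) (mdist y p).
  by rewrite lt_min !mdist_gt0 xp.
have d0 := mdist_ge0 x y.
rewrite tanh_half_ln1D ?divr_ge0// ?ltW//.
by field; rewrite !gt_eqF//; nra.
Qed.

Lemma tanh_tauE (R : realType) (X : metricType R) (p x y : X) :
  x != p -> y != p ->
  tanh (tau p x y / 2) =
  mdist x y / (mdist x y + Num.sqrt (mdist x p * mdist y p)).
Proof.
move=> xp yp; rewrite /tau.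
have s0 : 0 < Num.sqrt (mdist x p * mdist y p).
  by rewrite sqrtr_gt0 mulr_gt0// mdist_gt0.
have d0 := mdist_ge0 x y.
rewrite tanh_half_ln1D ?mulr_ge0// ?invr_ge0 ?ltW//.
by field; rewrite !gt_eqF//; nra.
Qed.

(** Compare squares: each of the two factors [min a b] is at most the matching factor of [a * b]. *)
Lemma min_le_sqrtM (R : rcfType) (a b : R) : 0 <= a -> 0 <= b ->
  Num.min a b <= Num.sqrt (a * b).
Proof.
move=> a0 b0; have m0 : 0 <= Num.min a b by rewrite le_min a0.
rewrite -[leLHS]ger0_norm// -sqrtr_sqr ler_wsqrtr// expr2.
by rewrite ler_pM// ge_min lexx ?orbT.
Qed.

Lemma sqrtM_le_max (R : rcfType) (a b : R) : 0 <= a -> 0 <= b ->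
  Num.sqrt (a * b) <= Num.max a b.
Proof.
move=> a0 b0; have m0 : 0 <= Num.max a b by rewrite le_max a0.
rewrite -[leRHS]ger0_norm// -sqrtr_sqr ler_wsqrtr// expr2.
by rewrite ler_pM// le_max lexx ?orbT.
Qed.

(** Confines the sharpness example to one coordinate axis, where distances are those of the real
    line. *)
Lemma edist_scale_delta (R : realType) (n : nat) (i : 'I_n) (a b : R) :
  Defs.edist (a *: delta_mx 0 i : 'rV[R]_n) (b *: delta_mx 0 i : 'rV[R]_n)
  = `|a - b|.
Proof.
rewrite /Defs.edist (bigD1 i)//= big1 => [|j ji]; rewrite !mxE eqxx/=.
  by rewrite eqxx !mulr1 addr0 sqrtr_sqr.
by rewrite (negbTE ji) !mulr0 subrr expr0n.
Qed.

Theorem theorem3p7 (R : realType) :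
  (forall (X : metricType R) (p x y : X), x != p -> y != p ->
     jstar p x y / 2 <= tanh (tau p x y / 2) /\
     tanh (tau p x y / 2) <= 2 * jstar p x y) /\
  (forall n : nat, (2 <= n)%N ->
     forall C : R, C < 2 ->
     ~ (forall x y : euclidean R n, x != 0 -> y != 0 ->
          tanh (tau (0 : euclidean R n) x y / 2)
            <= C * jstar (0 : euclidean R n) x y)).
Proof.
split=> [X p x y xp yp|n n2 C C2 H].
  rewrite jstarE// tanh_tauE//.
  have a0 : 0 < mdist x p by rewrite mdist_gt0.
  have b0 : 0 < mdist y p by rewrite mdist_gt0.
  have d0 := mdist_ge0 x y.
  have ms := min_le_sqrtM _ _ _ (ltW a0) (ltW b0).
  have sM := sqrtM_le_max _ _ _ (ltW a0) (ltW b0).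
  have m0 : 0 < Num.min (mdist x p) (mdist y p) by rewrite lt_min a0.
  (* The point farther from [p] reaches [p] through the nearer one. *)
  have Mm : Num.max (mdist x p) (mdist y p) <=
            Num.min (mdist x p) (mdist y p) + mdist x y.
    have := metric_triangle x y p; have := metric_triangle y x p.
    rewrite (metric_sym y x) /Num.max /Num.min.
    by case: ifP => _; lra.
  move: ms sM m0 Mm d0; set m := Num.min _ _; set M := Num.max _ _.
  set s := Num.sqrt _; set d := mdist x y => ms sM m0 Mm d0.
  split.
    (* Comparing denominators leaves [d + s <= 2 * (d + 2 * m)], which follows from
       [s <= M <= m + d]. *)
    rewrite -mulrA -invfM; apply: ler_wpM2l => //.
    by rewrite lef_pV2 ?posrE; lra.
  (* Here [(d + 2 * m) / 2 <= d + s] remains, and [m <= s] suffices. *)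
  rewrite mulrCA; apply: ler_wpM2l => //.
  by rewrite -[2 / _]invf_div lef_pV2 ?posrE; lra.
pose i : 'I_n := Ordinal (ltnW n2).
pose v (a : R) : euclidean R n := a *: delta_mx 0 i : 'rV[R]_n.
have vE a b : mdist (v a) (v b) = `|a - b| by exact: edist_scale_delta.
have v0 : v 0 = 0 by exact: scale0r.
have vN a : 0 < a -> v a != 0.
  move=> a0; apply/eqP => va0; have := vE a 0.
  by rewrite va0 v0 mdistxx subr0 gtr0_norm// => ?; lra.
have vd a : 0 < a -> mdist (v a) 0 = a.
  by move=> a0; rewrite -v0 vE subr0 gtr0_norm.
(* This choice means [C = 2 - 4 * e], so that [C * (1 + 2 * e) = 2 - 8 * e^2 < 2 + e]. *)
pose e := (2 - C) / 4; have e0 : 0 < e by rewrite /e; lra.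
have e1 : 0 < 1 + e by lra.
have := H (v 1) (v (1 + e)) (vN _ ltr01) (vN _ e1).
rewrite jstarE ?tanh_tauE ?vN// vE !vd//.
have -> : `|1 - (1 + e)| = e by rewrite opprD addNKr normrN gtr0_norm.
have le1e : 1 <= 1 + e by lra.
have := sqrtM_le_max _ _ _ ler01 (ltW e1).
have := min_le_sqrtM _ _ _ ler01 (ltW e1).
rewrite min_l// max_r//; set s := Num.sqrt _ => s1 s1e.
(* Cancelling [e] and clearing denominators turns the assumed bound into [e + 2 <= C * (e + s)]. For
   [C >= 0] this contradicts [s <= 1 + e] by the choice of [e]; for [C < 0] the right side is
   negative. *)
rewrite mulrCA ler_pM2l// mulr1 ler_pdivlMr; last by lra.
rewrite mulrC ler_pdivrMr; last by lra.
by rewrite /e in e0 e1 s1e *; nra.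
Qed.
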